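(* Let $E$ be a finite nonempty set and $u:2^E\to\mathbb{R}$ ordinally w-concave, and let $\mathbf{D}_u^*=\operatorname{Arg}\max\{u(X)\mid X\subseteq E\}$. For $X\in 2^E$ let $X^*$ denote any member of $\operatorname{Arg}\min\{|X\,\Delta\,Z|\mid Z\in\mathbf{D}_u^*\}$. Let $X,Y\in 2^E\setminus\mathbf{D}_u^*$ satisfy $X\cap X^*\subseteq Y\subseteq X\cup X^*$. Then there exist distinct $x\in(X^*\setminus Y)\cup\{\emptyset\}$ and $y\in(Y\setminus X^* )\cup\{\emptyset\}$ such that $u(Y)<u(Y-y+x)$.
   Context: Notation: $X\Delta Z$ is the symmetric difference. For $X\subseteq E$ and $x\in E\setminus X$, $X+x=X\cup\{x\}$; for $x\in X$, $X-x=X\setminus\{x\}$. The symbol $\emptyset$ is also used as a formal element not in $E$, with $X+\emptyset=X-\emptyset=X$. A function $u:2^E\to\mathbb{R}$ is ordinally w-concave if for every $X,X'\in 2^E$ with $X\neq X'$ there exist distinct $x\in(X\setminus X')\cup\{\emptyset\}$ and $x'\in(X'\setminus X)\cup\{\emptyset\}$ such that (i) $u(X)<u(X-x+x')$, or (ii) $u(X')<u(X'-x'+x)$, or (iii) $u(X)=u(X-x+x')$ and $u(X')=u(X'-x'+x)$. *)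

(* Defs.v *)
From mathcomp Require Import all_boot all_order all_algebra.
From mathcomp Require Import reals.

Set Implicit Arguments.
Unset Strict Implicit.
Unset Printing Implicit Defensive.

Import Order.TTheory GRing.Theory Num.Theory.
Local Open Scope ring_scope.

Section Defs.
Variables (R : realType) (E : finType).
Implicit Types (X Y Z W : {set E}) (u : {set E} -> R).

Definition symdiff X Z : {set E} := (X :\: Z) :|: (Z :\: X).

(* The formal element "emptyset" outside E is [None : option E]; an element   *)
(* [a] of E is [Some a]. Thus [with_empty A] is A together with the formal    *)
(* element, and adding or removing [None] does nothing.                       *)
Definition with_empty (A : {set E}) : {set option E} := None |: (Some @: A).

Definition addo X (x : option E) : {set E} := if x is Some a then a |: X else X.

Definition remo X (x : option E) : {set E} := if x is Some a then X :\ a else X.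

Definition ordinally_w_concave u : Prop :=
  forall X X' : {set E}, X != X' ->
  exists x x' : option E,
    [/\ x \in with_empty (X :\: X'),
        x' \in with_empty (X' :\: X),
        x != x'
      & [\/ u X < u (addo (remo X x) x'),
            u X' < u (addo (remo X' x') x)
          | u X = u (addo (remo X x) x') /\ u X' = u (addo (remo X' x') x)]].

Definition maximizers u : {set {set E}} :=
  [set Z | [forall W : {set E}, u W <= u Z]].

Definition nearest_maximizers u X : {set {set E}} :=
  [set Z in maximizers u |
    [forall W in maximizers u, (#|symdiff X Z| <= #|symdiff X W|)%N]].

End Defs.

(* Main.v *)
Require Import Defs.
From mathcomp Require Import all_boot all_order all_algebra.
From mathcomp Require Import reals.

Set Implicit Arguments.
Unset Strict Implicit.
Unset Printing Implicit Defensive.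

Import Order.TTheory GRing.Theory Num.Theory.
Local Open Scope ring_scope.

(* Apply w-concavity to the pair (X*, Y). The value at X* cannot increase, and
   if both values were preserved, X* - x + y would be a maximizer strictly
   closer to X, because x lies in X* \ X and y in X \ X*. *)

(** Dropping a genuine [x] from [Z], or adding a genuine [y], makes [Z] agree with [X] at that point
    and changes nothing elsewhere. As [x != y], they are not both [None], so at least one
    disagreement disappears. *)
Lemma symdiff_exchange_proper (E : finType) (X Z : {set E}) (x y : option E) :
    x \in with_empty (Z :\: X) -> y \in with_empty (X :\: Z) -> x != y ->
  symdiff X (addo (remo Z x) y) \proper symdiff X Z.
Proof.
have someE a (A : {set E}) : (Some a \in with_empty A) = (a \in A).
  by rewrite !inE /= mem_imset // => ? ? [].
move=> hx hy nxy; apply/properP; split.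
  apply/subsetP=> z; move: hx hy {nxy}.
  case: x => [a|]; case: y => [b|] /=; rewrite ?someE !inE //.
  - case/andP=> aX aZ /andP[bZ bX]; have [->|_] := eqVneq z b.
      by rewrite (negPf bZ) bX.
    by have [->|_] := eqVneq z a; rewrite ?(negPf aX).
  - by case/andP=> aX aZ _; have [->|_] := eqVneq z a; rewrite ?(negPf aX).
  by move=> _ /andP[bZ bX]; have [->|_] := eqVneq z b; rewrite ?(negPf bZ) ?bX.
(* The point lost is [x] when it is genuine; otherwise [y] is genuine and serves instead. *)
case: x hx nxy => [a|] hx nxy.
  exists a; move: hx; first by rewrite someE !inE => /andP[-> ->]; rewrite orbT.
  rewrite someE !inE => /andP[aX _].
  case: y hy nxy => [b|] /= hy nxy; rewrite !inE (negPf aX) eqxx ?andbF //.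
  by move/negPf: nxy; rewrite (inj_eq Some_inj) => ->.
case: y hy nxy => [b|//] hy _; move: hy; rewrite someE !inE => /andP[bZ bX].
by exists b; rewrite !inE ?eqxx bX ?bZ.
Qed.

Lemma with_emptyS (E : finType) (A B : {set E}) :
  A \subset B -> with_empty A \subset with_empty B.
Proof. by move=> sAB; apply/setUS/imsetS. Qed.

Theorem theorem2p4 (R : realType) (E : finType) (hE : (0 < #|E|)%N)
    (u : {set E} -> R) (hu : ordinally_w_concave u)
    (X Y Xstar : {set E})
    (hXstar : Xstar \in nearest_maximizers u X)
    (hX : X \notin maximizers u) (hY : Y \notin maximizers u)
    (hXY : X :&: Xstar \subset Y) (hYX : Y \subset X :|: Xstar) :
  exists x y : option E,
    [/\ x \in with_empty (Xstar :\: Y),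
        y \in with_empty (Y :\: Xstar),
        x != y
      & u Y < u (addo (remo Y y) x)].
Proof.
move: hXstar; rewrite !inE => /andP[/forallP maxXs /forallP nearXs].
have neq : Xstar != Y.
  by apply: contraNneq hY => <-; rewrite inE; apply/forallP.
have [x [y [hx hy nxy]]] := hu _ _ neq.
(* The second alternative is the goal itself; the tie is refuted below. *)
case=> [|lt_uY|[eqXs _]]; first by rewrite ltNge maxXs.
  by exists x, y.
(* By [hXY], a point of [Xstar] outside [Y] cannot lie in [X]. *)
have xXs : x \in with_empty (Xstar :\: X).
  apply: (subsetP (with_emptyS _)) hx; apply/subsetP=> z; rewrite !inE.
  case/andP=> zY zXs; rewrite zXs andbT; apply: contra zY => zX.
  by apply: (subsetP hXY); rewrite inE zX.
(* By [hYX], a point of [Y] outside [Xstar] must come from [X]. *)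
have yX : y \in with_empty (X :\: Xstar).
  apply: (subsetP (with_emptyS _)) hy; apply/subsetP=> z; rewrite !inE.
  case/andP=> zXs zY; rewrite zXs /=.
  by have := subsetP hYX z zY; rewrite inE (negPf zXs) orbF.
have /proper_card := symdiff_exchange_proper xXs yX nxy.
(* Minimality of the distance from [X] to [Xstar] contradicts the strict decrease once the exchanged
   set is known to be a maximizer, which [eqXs] gives. *)
rewrite ltnNge; have /implyP-> // := nearXs (addo (remo Xstar x) y).
by rewrite inE -eqXs; apply/forallP.
Qed.
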